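(* Let $n$ be a natural number, let $\mathfrak{T}$ and $\mathfrak{S}$ be $\mathcal{L}$-trees, and let $a\in T$ and $b\in S$ be such that $(\mathfrak{T};a)\equiv^{n+1}(\mathfrak{S};b)$. Then $\left(\mathfrak{T}_{\mathsf{cf}}^{a};a\right)\equiv^n\left(\mathfrak{S}_{\mathsf{cf}}^{b};b\right)$.
   Context: A tree is a structure $\mathfrak{T}=(T;<)$ with $T$ non-empty and $<$ a strict partial order that is downwards linear (each set $\{x : x \leqslant t\}$ is totally ordered) and downwards connected (for all $s,t$ there is $x$ with $x\leqslant s$ and $x\leqslant t$). The language $\mathcal{L}$ consists of $=$, $<$ and finitely many constants and unary predicates; an $\mathcal{L}$-tree is a tree in this language. $(\mathfrak{T};a)$ denotes the expansion by a constant $a$. $\equiv^n$ denotes agreement on all first-order sentences of quantifier rank at most $n$. Natural numbers include $0$. For $a\in T$, the co-forest $\mathfrak{T}_{\mathsf{cf}}^{a}$ is the restriction of $\mathfrak{T}$ to $T_{\mathsf{cf}}^{a}=\{x\in T : a\not<x\text{ and } y<x\text{ for all }y<a\}$. When a tree is restricted to a subset, constants of the language lying outside the subset are dropped; $n$-equivalence of two restrictions includes that the same constants are retained in both. *)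

(* Defs.v *)
From HB Require Import structures.
From mathcomp Require Import all_boot.
From mathcomp Require Import boolp classical_sets.

Set Implicit Arguments.
Unset Strict Implicit.
Unset Printing Implicit Defensive.

(* Structures for the language with equality, [<], constant symbols [C] and
   unary predicate symbols [P].  Constants are interpreted partially so that a
   restriction can drop those lying outside the subset: the language of a
   structure [M] contains exactly the [c : C] with [const M c <> None]. *)
Record structure (C P : Type) : Type := Structure {
  carrier :> Type;
  lt : carrier -> carrier -> Prop;
  const : C -> option carrier;
  upred : P -> carrier -> Prop
}.

Definition le (C P : Type) (M : structure C P) (x y : M) : Prop :=
  lt x y \/ x = y.

Record ltree (C P : Type) : Type := LTree {
  ltree_structure :> structure C P;
  const_total : forall c, const ltree_structure c <> None;
  ltree_inhabited : inhabited ltree_structure;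
  lt_irrefl : forall x : ltree_structure, ~ lt x x;
  lt_trans : forall x y z : ltree_structure, lt x y -> lt y z -> lt x z;
  down_linear : forall t x y : ltree_structure,
    le x t -> le y t -> le x y \/ le y x;
  down_connected : forall s t : ltree_structure,
    exists x : ltree_structure, le x s /\ le x t
}.

(* The new constant symbol is [None : option C]. *)
Definition expand (C P : Type) (M : structure C P) (a : M) :
    structure (option C) P :=
  @Structure (option C) P M (@lt C P M)
    (fun c => if c is Some c' then const M c' else Some a) (@upred C P M).

Definition restrict (C P : Type) (M : structure C P) (X : set M) :
    structure C P :=
  @Structure C P {x : M | x \in X}
    (fun x y => lt (val x) (val y))
    (fun c => obind insub (const M c))
    (fun p x => upred p (val x)).

Section Formulas.
Variables C P : Type.

Inductive term (k : nat) : Type :=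
  | Var of 'I_k
  | Cst of C.

(* [formula k]: first-order formulas with free variables among [Var i],
   [i : 'I_k].  A quantifier binds variable 0 of its body and shifts the
   others (de Bruijn indices). *)
Inductive formula : nat -> Type :=
  | Bot k : formula k
  | Eq k : term k -> term k -> formula k
  | Lt k : term k -> term k -> formula k
  | Upred k : P -> term k -> formula k
  | Imp k : formula k -> formula k -> formula k
  | And k : formula k -> formula k -> formula k
  | Or k : formula k -> formula k -> formula k
  | All k : formula k.+1 -> formula k
  | Ex k : formula k.+1 -> formula k.

Definition sentence : Type := formula 0.

Fixpoint qrank (k : nat) (f : formula k) : nat :=
  match f with
  | Bot _ | Eq _ _ _ | Lt _ _ _ | Upred _ _ _ => 0
  | Imp _ g h | And _ g h | Or _ g h => maxn (qrank g) (qrank h)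
  | All _ g | Ex _ g => (qrank g).+1
  end.

Section Semantics.
Variable M : structure C P.

Definition term_in_lang (k : nat) (t : term k) : Prop :=
  if t is Cst c then const M c <> None else True.

Fixpoint in_lang (k : nat) (f : formula k) : Prop :=
  match f with
  | Bot _ => True
  | Eq _ t u | Lt _ t u => term_in_lang t /\ term_in_lang u
  | Upred _ _ t => term_in_lang t
  | Imp _ g h | And _ g h | Or _ g h => in_lang g /\ in_lang h
  | All _ g | Ex _ g => in_lang g
  end.

Definition teval (k : nat) (e : k.-tuple M) (t : term k) : option M :=
  match t with
  | Var i => Some (tnth e i)
  | Cst c => const M c
  end.

(* Only used on formulas satisfying [in_lang]; an atomic formula containing an
   uninterpreted constant is given the junk value [False]. *)
Fixpoint sat (k : nat) (f : formula k) : k.-tuple M -> Prop :=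
  match f with
  | Bot _ => fun _ => False
  | Eq _ t u => fun e =>
      if (teval e t, teval e u) is (Some x, Some y) then x = y else False
  | Lt _ t u => fun e =>
      if (teval e t, teval e u) is (Some x, Some y) then lt x y else False
  | Upred _ p t => fun e => if teval e t is Some x then upred p x else False
  | Imp _ g h => fun e => sat g e -> sat h e
  | And _ g h => fun e => sat g e /\ sat h e
  | Or _ g h => fun e => sat g e \/ sat h e
  | All _ g => fun e => forall x : M, sat g [tuple of x :: e]
  | Ex _ g => fun e => exists x : M, sat g [tuple of x :: e]
  end.

Definition models (f : sentence) : Prop := sat f [tuple].

End Semantics.

Definition nequiv (n : nat) (M N : structure C P) : Prop :=
  (forall c, const M c <> None <-> const N c <> None) /\
  (forall f : sentence, in_lang M f -> qrank f <= n ->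
    (models M f <-> models N f)).

End Formulas.

Section CoForest.
Variables (C P : Type) (T : ltree C P) (a : T).

Definition cf_set : set T :=
  [set x | ~ lt a x /\ forall y : T, lt y a -> lt y x]%classic.

Definition coforest : structure C P := restrict cf_set.

Lemma cf_set_base : a \in cf_set.
Proof. by rewrite inE; split=> //; exact: lt_irrefl. Qed.

Definition cf_base : coforest := exist _ a cf_set_base.

End CoForest.

(* Main.v *)
(** The co-forest at [a] is defined in [(T; a)] by a formula of quantifier
    rank 1, so relativizing to it a sentence of rank [n] gives a sentence of
    rank at most [n.+1]: the guard is evaluated in parallel with the body of
    the quantifier, so the rank goes up by one in total and not once per
    quantifier. *)

Require Import Defs.
From mathcomp Require Import all_boot.
From mathcomp Require Import boolp classical_sets.

Set Implicit Arguments.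
Unset Strict Implicit.
Unset Printing Implicit Defensive.

Section Formulas.
Variables C P : Type.

Definition lift_term (k : nat) (t : term C k) : term C k.+1 :=
  match t with
  | Var i => Var C (lift ord0 i)
  | Cst c => Cst k.+1 c
  end.

Lemma teval_lift_term (M : structure C P) (k : nat) (e : k.-tuple M) (x : M)
    (t : term C k) :
  teval [tuple of x :: e] (lift_term t) = teval e t.
Proof. by case: t => //= i; rewrite tnthS. Qed.

Lemma in_lang_sub (M N : structure C P) (k : nat) (f : formula C P k) :
  (forall c, const M c <> None -> const N c <> None) ->
  in_lang M f -> in_lang N f.
Proof.
move=> sMN; have term_sub j (t : term C j) : term_in_lang M t -> term_in_lang N t.
  by case: t => //= c /sMN.
elim: f => //= {}k.
- by move=> t u [/term_sub ? /term_sub].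
- by move=> t u [/term_sub ? /term_sub].
- by move=> p t /term_sub.
- by move=> g IHg h IHh [/IHg ? /IHh].
- by move=> g IHg h IHh [/IHg ? /IHh].
- by move=> g IHg h IHh [/IHg ? /IHh].
Qed.

Lemma in_lang_total (M : structure C P) (k : nat) (f : formula C P k) :
  (forall c, const M c <> None) -> in_lang M f.
Proof.
move=> totM; have term_total j (t : term C j) : term_in_lang M t by case: t.
by elim: f => /=.
Qed.

End Formulas.

Section Relativization.
Variables C P : Type.

(** The argument is an arbitrary term because the formula has two uses: at variable 0 it guards a
    quantifier, and at a constant of [C] it tests whether the restriction keeps that constant. The
    constant [None] names the base point. *)
Definition in_cf (k : nat) (t : term (option C) k) : formula (option C) P k :=
  And (Imp (Lt P (Cst k None) t) (Bot (option C) P k))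
      (All (Imp (Lt P (Var (option C) ord0) (Cst k.+1 None))
                (Lt P (Var (option C) ord0) (lift_term t)))).

#[local] Arguments in_cf : simpl never.

Fixpoint cf_rel (k : nat) (f : formula (option C) P k) :
    formula (option C) P k :=
  match f with
  | Imp _ g h => Imp (cf_rel g) (cf_rel h)
  | And _ g h => And (cf_rel g) (cf_rel h)
  | Or _ g h => Or (cf_rel g) (cf_rel h)
  | All _ g => All (Imp (in_cf (Var (option C) ord0)) (cf_rel g))
  | Ex _ g => Ex (And (in_cf (Var (option C) ord0)) (cf_rel g))
  | g => g
  end.

Lemma qrank_cf_rel (k n : nat) (f : formula (option C) P k) :
  qrank f <= n -> qrank (cf_rel f) <= n.+1.
Proof.
elim: f n => //= {}k.
- by move=> g IHg h IHh n; rewrite !geq_max => /andP[/IHg -> /IHh ->].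
- by move=> g IHg h IHh n; rewrite !geq_max => /andP[/IHg -> /IHh ->].
- by move=> g IHg h IHh n; rewrite !geq_max => /andP[/IHg -> /IHh ->].
(* A quantifier forces a positive bound, so [n.+1] remains below the outer quantifier and leaves
   room for the guard, of rank 1. *)
- by move=> g IHg [//|n] /IHg; rewrite !ltnS !geq_max.
- by move=> g IHg [//|n] /IHg; rewrite !ltnS !geq_max.
Qed.

Lemma expand_total (T : ltree C P) (a : T) (c : option C) :
  const (expand a) c <> None.
Proof. by case: c => //= c; exact: const_total. Qed.

Lemma sat_in_cf (T : ltree C P) (a x : T) (k : nat)
    (e : k.-tuple (expand a)) (t : term (option C) k) :
  teval e t = Some x -> sat (in_cf t) e <-> x \in cf_set a.
Proof.
move=> etx; rewrite inE /in_cf /= etx.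
by split=> -[ax yx]; split=> // y; move: (yx y); rewrite teval_lift_term etx.
Qed.

Lemma sat_in_cf_Var0 (T : ltree C P) (a x : T) (k : nat)
    (e : k.-tuple (expand a)) :
  @sat _ _ (expand a) _ (in_cf (Var (option C) ord0)) [tuple of x :: e] <->
  x \in cf_set a.
Proof. exact: sat_in_cf. Qed.

(** This turns the retention of a constant into a sentence of rank 1, within the bound [n.+1] even
    when [n] is 0. *)
Lemma const_coforest (T : ltree C P) (a : T) (c : C) :
  const (coforest a) c <> None <->
  models (expand a) (in_cf (Cst 0 (Some c))).
Proof.
rewrite /models; case cx: (const T c) => [x|]; last first.
  by have := @const_total _ _ T c.
rewrite (@sat_in_cf _ a x) //= cx /=.
by case: insubP => [u xcf _|/negPf ->].
Qed.

(** A dropped constant has a value in [T] but none in the co-forest; [term_in_lang] excludes it. The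
    constant [None] is always kept, as [a] lies in its own co-forest. *)
Lemma teval_coforest (T : ltree C P) (a : T) (k : nat)
    (e : k.-tuple (expand (cf_base a))) (t : term (option C) k) :
  term_in_lang (expand (cf_base a)) t ->
  exists2 x : coforest a, teval e t = Some x &
    @teval _ _ (expand a) _ [tuple of map val e] t = Some (val x).
Proof.
case: t => [i|[c|]] /=.
- by exists (tnth e i); rewrite ?tnth_map.
- case: (const T c) => //= x; case: insubP => // u _ <- _.
  by exists u.
- by exists (cf_base a).
Qed.

(** Atoms transfer because the restriction inherits order and predicates; [in_lang] keeps out the
    junk value [False], which could disagree with [T]. Quantifiers transfer because the guard holds
    exactly at the elements of the co-forest. *)
Lemma sat_cf_rel (T : ltree C P) (a : T) (k : nat)
    (f : formula (option C) P k) (e : k.-tuple (expand (cf_base a))) :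
  in_lang (expand (cf_base a)) f ->
  sat f e <-> @sat _ _ (expand a) _ (cf_rel f) [tuple of map val e].
Proof.
(* The two tuples have the same entries but different size proofs. *)
have map_val_cons j (x : coforest a) (d : j.-tuple (coforest a)) :
    [tuple of map val (x :: d)] = [tuple of val x :: map val d].
  exact: val_inj.
elim: f e => //= {}k.
- move=> t u e [/(teval_coforest e)[x -> ->] /(teval_coforest e)[y -> ->]].
  by split=> [->//|/val_inj].
- by move=> t u e [/(teval_coforest e)[x -> ->] /(teval_coforest e)[y -> ->]].
- by move=> p t e /(teval_coforest e)[x -> ->].
- by move=> g IHg h IHh e [lg lh]; rewrite IHg // IHh.
- by move=> g IHg h IHh e [lg lh]; rewrite IHg // IHh.
- by move=> g IHg h IHh e [lg lh]; rewrite IHg // IHh.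
(* The guard supplies the membership proof that makes [x] a point of the co-forest; conversely
   [valP] discharges the guard. *)
- move=> g IHg e lg; split=> [satg x /sat_in_cf_Var0 xcf|satg x].
    have := satg (exist _ x (xcf)).
    by rewrite IHg // map_val_cons.
  rewrite IHg //; have := satg (val x).
  by rewrite map_val_cons; apply; apply/sat_in_cf_Var0; exact: valP.
- move=> g IHg e lg; split=> [[x]|[x [/sat_in_cf_Var0 xcf satg]]].
    rewrite IHg // map_val_cons => satg; exists (val x); split=> //.
    by apply/sat_in_cf_Var0; exact: valP.
  by exists (exist _ x (xcf)); rewrite IHg // map_val_cons.
Qed.

End Relativization.

Theorem lemma3p4 (C P : finType) (n : nat) (T S : ltree C P) (a : T) (b : S) :
  nequiv n.+1 (expand a) (expand b) ->
  nequiv n (expand (cf_base a)) (expand (cf_base b)).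
Proof.
case=> _ ab_equiv.
(* Trees interpret every constant, so every sentence is in the language of [expand a]. *)
have ab_models f : qrank f <= n.+1 -> models (expand a) f <-> models (expand b) f.
  by apply: ab_equiv; apply: in_lang_total; exact: expand_total.
have constE c : const (expand (cf_base a)) c <> None <->
                const (expand (cf_base b)) c <> None.
  by case: c => // c; rewrite /= !const_coforest ab_models.
split=> // f fa fn.
(* The relativization is applied on both sides, so [f] must also be in the language of the co-forest
   at [b]; equal retention of constants gives this. *)
have fb : in_lang (expand (cf_base b)) f.
  by apply: in_lang_sub fa => c /constE.
have nilE (X Y : Type) (h : X -> Y) : [tuple of map h [tuple]] = [tuple].
  exact: val_inj.
rewrite /models !sat_cf_rel // !nilE.
exact/ab_models/qrank_cf_rel.
Qed.
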